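(* Let $1<\alpha_1,\alpha_2<2$, $k_x,k_y>0$, $\eta>0$, $T>0$, and let $\hat f$ be Lipschitz continuous in its first argument (with Lipschitz constant $c_2>0$ uniform in $(x,y,t)$). Then the finite difference scheme (S) given in the context is unconditionally stable. That is, there is a constant $C>0$, independent of the step sizes $h_x,h_y,\Delta t$ (equivalently of $n_1,n_2,m$), such that for all positive integers $n_1,n_2,m$, without any restriction relating the step sizes, and for any two solutions $(u_{i,j}^k)$ and $(\tilde u_{i,j}^k)$ of (S) that start from possibly different initial values, the errors $\epsilon_{i,j}^k=\tilde u_{i,j}^k-u_{i,j}^k$ satisfy $$\max_{1\le i\le n_1,\,1\le j\le n_2}|\epsilon_{i,j}^k|\le C\max_{1\le i\le n_1,\,1\le j\le n_2}|\epsilon_{i,j}^0|,\qquad 1\le k\le m.$$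
   Context: $\Omega\subset\mathbb{R}^2$ is a convex region contained in the rectangle $\bar\Omega=(a,b)\times(c,d)$. The function $f(u,x,y,t)$ is defined for $(x,y)\in\Omega$, $t\in[0,T]$ and is Lipschitz in $u$ and in $t$. $\hat f$ is its extension by zero: $\hat f(u,x,y,t)=f(u,x,y,t)$ for $(x,y)\in\Omega$ and $\hat f(u,x,y,t)=0$ for $(x,y)\in\bar\Omega\setminus\Omega$. Hence $|\hat f(u_1,x,y,t)-\hat f(u_2,x,y,t)|\le c_2|u_1-u_2|$. $\hat u_0$ denotes the extension to $\bar\Omega$ of the initial function $u_0$. Grid: for positive integers $n_1,n_2,m$, $h_x=\frac{b-a}{n_1+1}$, $h_y=\frac{d-c}{n_2+1}$, $\Delta t=\frac{T}{m}$, $x_i=a+ih_x$, $y_j=c+jh_y$, $t_k=k\Delta t$. Coefficients: $g_0^{(\alpha)}=1$, $g_l^{(\alpha)}=\left(1-\frac{\alpha+1}{l}\right)g_{l-1}^{(\alpha)}$ for $l\ge1$; $c_{\alpha}=-\frac{1}{2\cos(\alpha\pi/2)}>0$; $c_x=\frac{\Delta t\,k_xc_{\alpha_1}}{h_x^{\alpha_1}}$, $c_y=\frac{\Delta t\,k_yc_{\alpha_2}}{h_y^{\alpha_2}}$; $d_{i,j}=0$ if $(x_i,y_j)\in\Omega$ and $d_{i,j}=\frac{\Delta t}{\eta}$ if $(x_i,y_j)\in\bar\Omega\setminus\Omega$. Scheme (S): for $1\le i\le n_1$, $1\le j\le n_2$, $1\le k\le m$, $$u_{i,j}^{k}-c_x\Big(\sum_{l=0}^{i+1}g_{l}^{(\alpha_1)}u_{i-l+1,j}^k+\sum_{l=0}^{n_1-i+2}g_{l}^{(\alpha_1)}u_{i+l-1,j}^k\Big)-c_y\Big(\sum_{l=0}^{j+1}g_{l}^{(\alpha_2)}u_{i,j-l+1}^{k}+\sum_{l=0}^{n_2-j+2}g_{l}^{(\alpha_2)}u_{i,j+l-1}^k\Big)+d_{i,j}u_{i,j}^{k}=u_{i,j}^{k-1}+\Delta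 t\,\hat f(u_{i,j}^{k-1},x_i,y_j,t_{k-1}),$$ with initial values $u_{i,j}^0=\hat u_0(x_i,y_j)$ and boundary values $u_{0,j}^{k}=u_{n_1+1,j}^{k}=u_{i,0}^{k}=u_{i,n_2+1}^{k}=0$. A perturbed solution $\tilde u$ satisfies the same equations and boundary conditions with different initial values. *)

(* Defs.v *)
From HB Require Import structures.
From mathcomp Require Export all_boot all_order all_algebra.
From mathcomp Require Export all_classical all_reals all_analysis.
Export Order.TTheory GRing.Theory Num.Theory.
Export numFieldNormedType.Exports.
Set Implicit Arguments.
Unset Strict Implicit.
Unset Printing Implicit Defensive.
Local Open Scope classical_set_scope.
Local Open Scope ring_scope.

Definition rectangle (R : realType) (a b c d : R) : set (R * R) :=
  `]a, b[%classic `*` `]c, d[%classic.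

(* R^o * R^o, rather than R * R, carries the R-module structure. *)
Definition convex_region (R : realType) (Omega : set (R * R)) : Prop :=
  @convex_set R (R^o * R^o)%type Omega.

Definition ext0 (R : realType) (Omega : set (R * R)) (f : R -> R -> R -> R -> R)
    (u x y t : R) : R :=
  if (x, y) \in Omega then f u x y t else 0.

(* Grid with n interior nodes between the endpoints a = node 0 and
   b = node n.+1. *)
Definition step (R : realType) (a b : R) (n : nat) : R := (b - a) / n.+1%:R.

Definition node (R : realType) (a b : R) (n i : nat) : R :=
  a + i%:R * step a b n.

Definition tstep (R : realType) (T : R) (m : nat) : R := T / m%:R.

Definition tnode (R : realType) (T : R) (m k : nat) : R := k%:R * tstep T m.

Fixpoint gcoef (R : realType) (alpha : R) (l : nat) : R :=
  if l is l'.+1 then (1 - (alpha + 1) / l%:R) * gcoef alpha l' else 1.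

Definition ccoef (R : realType) (alpha : R) : R :=
  - (1 / (2 * cos (alpha * pi / 2))).

(* c_x and c_y, with h the spatial step and dt the time step. *)
Definition diffusion_coef (R : realType) (dt kappa alpha h : R) : R :=
  dt * kappa * ccoef alpha / h `^ alpha.

Definition penalty_coef (R : realType) (Omega : set (R * R)) (dt eta x y : R)
    : R :=
  if (x, y) \in Omega then 0 else dt / eta.

(* The two one-sided shifted Gruenwald sums at node i of a grid function v on
   {0, ..., n.+1}.  The indices i.+1 - l and (i + l).-1 never truncate for
   1 <= i <= n and l in the range of summation. *)
Definition gsum (R : realType) (alpha : R) (n : nat) (v : nat -> R) (i : nat)
    : R :=
  \sum_(0 <= l < i.+2) gcoef alpha l * v (i.+1 - l)%N
  + \sum_(0 <= l < (n - i).+3) gcoef alpha l * v (i + l).-1.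

(* The grid function u i j k stands for u_{i,j}^k; only its values for
   i <= n1.+1, j <= n2.+1, k <= m are constrained. *)
Definition scheme_equations (R : realType) (Omega : set (R * R))
    (a b c d T kx ky alpha1 alpha2 eta : R) (f : R -> R -> R -> R -> R)
    (n1 n2 m : nat) (u : nat -> nat -> nat -> R) : Prop :=
  let hx := step a b n1 in
  let hy := step c d n2 in
  let dt := tstep T m in
  let cx := diffusion_coef dt kx alpha1 hx in
  let cy := diffusion_coef dt ky alpha2 hy in
  forall i j k : nat,
    (1 <= i <= n1)%N -> (1 <= j <= n2)%N -> (1 <= k <= m)%N ->
    let x := node a b n1 i in
    let y := node c d n2 j in
    u i j k
      - cx * gsum alpha1 n1 (fun i' => u i' j k) i
      - cy * gsum alpha2 n2 (fun j' => u i j' k) j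
      + penalty_coef Omega dt eta x y * u i j k
    = u i j k.-1
      + dt * ext0 Omega f (u i j k.-1) x y (tnode T m k.-1).

Definition zero_boundary (R : realType) (n1 n2 m : nat)
    (u : nat -> nat -> nat -> R) : Prop :=
  forall k : nat, (1 <= k <= m)%N ->
    (forall j : nat, (j <= n2.+1)%N -> u 0%N j k = 0 /\ u n1.+1 j k = 0) /\
    (forall i : nat, (i <= n1.+1)%N -> u i 0%N k = 0 /\ u i n2.+1 k = 0).

Definition initial_values (R : realType) (a b c d : R) (n1 n2 : nat)
    (u0 : R -> R -> R) (u : nat -> nat -> nat -> R) : Prop :=
  forall i j : nat, (1 <= i <= n1)%N -> (1 <= j <= n2)%N ->
    u i j 0%N = u0 (node a b n1 i) (node c d n2 j).

Definition scheme_solution (R : realType) (Omega : set (R * R))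
    (a b c d T kx ky alpha1 alpha2 eta : R) (f : R -> R -> R -> R -> R)
    (n1 n2 m : nat) (u0 : R -> R -> R) (u : nat -> nat -> nat -> R) : Prop :=
  [/\ scheme_equations Omega a b c d T kx ky alpha1 alpha2 eta f n1 n2 m u,
      zero_boundary n1 n2 m u &
      initial_values a b c d n1 n2 u0 u].

(* Maximum of |e i j| over the interior nodes; the default 0 is harmless since
   absolute values are nonnegative. *)
Definition grid_max (R : realType) (n1 n2 : nat) (e : nat -> nat -> R) : R :=
  \big[Num.max/0]_(1 <= i < n1.+1) \big[Num.max/0]_(1 <= j < n2.+1) `|e i j|.

(* Main.v *)
Require Import Defs.
From mathcomp Require Import lra ring zify.
Local Open Scope classical_set_scope.
Local Open Scope ring_scope.

(* Discrete maximum principle: at a node where the error |e^k| is maximal, the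
   Gruenwald weights are nonnegative except for the one at the node itself and
   have nonpositive sums, so the implicit diffusion terms, like the penalty
   term, can only increase the left-hand side in modulus.  Hence
   max|e^k| <= (1 + dt c2) max|e^(k-1)|, and (1 + T c2 / m)^m <= exp (c2 T). *)

(** The recursion factor [1 - (alpha + 1) / l] is negative for l = 1 and l = 2, so g_1 = -alpha is
    negative but g_2 = alpha (alpha - 1) / 2 is positive again. From l = 3 on every factor is
    positive because alpha + 1 < 3. *)
Lemma gcoef_ge0 {R : realType} (alpha : R) (l : nat) :
  1 < alpha < 2 -> l != 1%N -> 0 <= gcoef alpha l.
Proof.
move=> /andP[a1 a2]; case: l => [|[|l]]; rewrite /= ?ler01 // => _.
elim: l => [|l IHl]; last first.
  apply: mulr_ge0 => //.
  by rewrite subr_ge0 ler_pdivrMr ?ltr0n // mul1r -!natr1; have := ler0n R l; lra.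
by rewrite /=; nra.
Qed.

(** Each partial sum is a negative multiple of the first omitted weight, whose index here is at
    least 2. The range has to include l = 1, since g_0 alone equals 1. *)
Lemma sum_gcoef_le0 {R : realType} (alpha : R) (n : nat) :
  1 < alpha < 2 -> \sum_(0 <= l < n.+2) gcoef alpha l <= 0.
Proof.
move=> /andP[a1 a2].
have sumE p : \sum_(0 <= l < p.+1) gcoef alpha l
    = - (p.+1%:R / alpha) * gcoef alpha p.+1.
  elim: p => [|p IHp]; first by rewrite big_nat1 /=; field; lra.
  rewrite big_nat_recr //= IHp /=.
  have p0 := ler0n R p.
  by field; apply/and3P; split; lra.
rewrite sumE mulNr oppr_le0 mulr_ge0 ?gcoef_ge0 ?a1 //.
by rewrite divr_ge0 ?ler0n //; lra.
Qed.

Lemma ccoef_gt0 {R : realType} (alpha : R) : 1 < alpha < 2 -> 0 < ccoef alpha.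
Proof.
move=> /andP[a1 a2]; have p0 := pi_gt0 R.
(* The angle alpha pi / 2 lies between pi / 2 and pi; reflecting it at pi / 2 moves it to where the
   cosine is positive. *)
have c0 : 0 < cos (pi - alpha * pi / 2) by apply: cos_gt0_pihalf; apply/andP; split; nra.
rewrite /ccoef oppr_gt0 mul1r invr_lt0.
by move: c0; rewrite cosB cospi sinpi; lra.
Qed.

Lemma diffusion_coef_ge0 {R : realType} (dt kappa alpha h : R) :
  0 <= dt -> 0 < kappa -> 1 < alpha < 2 -> 0 <= diffusion_coef dt kappa alpha h.
Proof.
move=> dt0 k0 a12; rewrite /diffusion_coef.
by rewrite divr_ge0 ?powR_ge0 // !mulr_ge0 // ltW // ccoef_gt0.
Qed.

(* Only the term [l = 1] has a negative weight, and it multiplies [v i] itself,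
   so every [v _] may be replaced by the maximum [v i]. *)
Lemma gsum_max_le0 {R : realType} (alpha : R) (n : nat) (v : nat -> R) (i : nat) :
  1 < alpha < 2 -> (1 <= i <= n)%N -> 0 <= v i ->
  (forall i', (i' <= n.+1)%N -> v i' <= v i) -> gsum alpha n v i <= 0.
Proof.
move=> a12 /andP[i1 ile] vi0 vmax.
(* The index map [w] stands for either one-sided shift: both hit the node i at l = 1 and stay
   between 0 and n + 1. *)
have sum_le0 p (w : nat -> nat) : w 1%N = i ->
    (forall l, (l < p.+2)%N -> (w l <= n.+1)%N) ->
    \sum_(0 <= l < p.+2) gcoef alpha l * v (w l) <= 0.
  move=> w1 wle; apply: (@le_trans _ _ (\sum_(0 <= l < p.+2) gcoef alpha l * v i)).
    apply: ler_sum_nat => l /andP[_ lp].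
    have [->|l1] := eqVneq l 1%N; first by rewrite w1.
    by rewrite ler_wpM2l ?gcoef_ge0 // vmax // wle.
  by rewrite -mulr_suml mulr_le0_ge0 ?sum_gcoef_le0.
rewrite /gsum -[leRHS]addr0; apply: lerD.
  by apply: (sum_le0 i (fun l => i.+1 - l)%N) => [|l lp]; lia.
by apply: (sum_le0 (n - i).+1 (fun l => (i + l).-1)) => [|l lp]; lia.
Qed.

Lemma gsumB {R : realType} (alpha : R) (n : nat) (v w : nat -> R) (i : nat) :
  gsum alpha n (fun i' => v i' - w i') i = gsum alpha n v i - gsum alpha n w i.
Proof.
rewrite /gsum opprD addrACA -!sumrB.
by congr (_ + _); apply: eq_bigr => l _; rewrite mulrBr.
Qed.

Lemma gsumZ {R : realType} (alpha : R) (n : nat) (s : R) (v : nat -> R) (i : nat) :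
  gsum alpha n (fun i' => s * v i') i = s * gsum alpha n v i.
Proof.
rewrite /gsum mulrDr !mulr_sumr.
by congr (_ + _); apply: eq_bigr => l _; rewrite mulrCA.
Qed.

Lemma node_itv {R : realType} (a b : R) (n i : nat) :
  a < b -> (1 <= i <= n)%N -> a < node a b n i < b.
Proof.
move=> ab /andP[i1 ile]; rewrite /node /step.
have n0 : 0 < n.+1%:R :> R by rewrite ltr0n.
have i0 : 0 < i%:R :> R by rewrite ltr0n.
have iltn : i%:R < n.+1%:R :> R by rewrite ltr_nat ltnS.
have ba : 0 < b - a by rewrite subr_gt0.
rewrite ltrDl mulr_gt0 ?divr_gt0 //= addrC -ltrBrDr mulrCA.
by rewrite -[ltRHS]mulr1 ltr_pM2l // ltr_pdivrMr // mul1r.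
Qed.

Lemma penalty_coef_ge0 {R : realType} (Omega : set (R * R)) (dt eta x y : R) :
  0 <= dt -> 0 <= eta -> 0 <= penalty_coef Omega dt eta x y.
Proof. by rewrite /penalty_coef; case: ifP => // _ *; rewrite divr_ge0. Qed.

Lemma ge_grid_max {R : realType} (n1 n2 : nat) (e : nat -> nat -> R) (M : R) :
  0 <= M ->
  (forall i j, (1 <= i <= n1)%N -> (1 <= j <= n2)%N -> `|e i j| <= M) ->
  grid_max n1 n2 e <= M.
Proof.
move=> M0 eM; rewrite /grid_max big_nat; apply: bigmax_le => // i i1.
by rewrite big_nat; apply: bigmax_le => // j j1; exact: eM.
Qed.

Lemma le_grid_max {R : realType} {n1 n2 : nat} (e : nat -> nat -> R) {i j : nat} :
  (1 <= i <= n1)%N -> (1 <= j <= n2)%N -> `|e i j| <= grid_max n1 n2 e.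
Proof.
move=> i1 j1; apply: (@le_trans _ _ (\big[Num.max/0]_(1 <= j < n2.+1) `|e i j|)).
  by apply: (le_bigmax_seq 0 _ xpredT (fun j => `|e i j|)); rewrite // mem_index_iota.
apply: (le_bigmax_seq 0 _ xpredT (fun i => \big[Num.max/0]_(1 <= j < n2.+1) `|e i j|)) => //.
by rewrite mem_index_iota.
Qed.

Lemma grid_max_ge0 {R : realType} (n1 n2 : nat) (e : nat -> nat -> R) :
  0 <= grid_max n1 n2 e.
Proof. exact: bigmax_ge_id. Qed.

Lemma grid_argmax {R : realType} {n1 n2 : nat} (e : nat -> nat -> R) :
  (0 < n1)%N -> (0 < n2)%N ->
  exists i j, [/\ (1 <= i <= n1)%N, (1 <= j <= n2)%N &
    forall i' j', (1 <= i' <= n1)%N -> (1 <= j' <= n2)%N -> `|e i' j'| <= `|e i j|].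
Proof.
case: n1 n2 => [//|n1] [//|n2] _ _.
(* Ordinals start at 0 and interior indices at 1, hence the successors. *)
pose F (p : 'I_n1.+1 * 'I_n2.+1) := `|e p.1.+1 p.2.+1|.
have [/= [i j] _ Fmax] := @arg_maxP _ R _ (ord0, ord0) xpredT F isT.
exists i.+1, j.+1; split=> [||[|i'] [|j'] //= ilt jlt].
- by rewrite /= ltn_ord.
- by rewrite /= ltn_ord.
- exact: (Fmax (Ordinal ilt, Ordinal jlt)).
Qed.

(** Diffusion and penalty are taken at the new time level, where the maximum principle fixes their
    sign for any step sizes. Only the source, taken at the old level, lets the error grow, through
    its Lipschitz constant. *)
Lemma scheme_step {R : realType} {Omega : set (R * R)} {a b c d : R}
    {T kx ky alpha1 alpha2 eta c2 : R} {f : R -> R -> R -> R -> R}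
    {n1 n2 m k : nat} {u v : nat -> nat -> nat -> R} :
  a < b -> c < d -> 1 < alpha1 < 2 -> 1 < alpha2 < 2 ->
  0 < kx -> 0 < ky -> 0 < eta -> 0 < T -> 0 < c2 ->
  (forall u1 u2 x y t : R, rectangle a b c d (x, y) -> 0 <= t <= T ->
     `|ext0 Omega f u1 x y t - ext0 Omega f u2 x y t| <= c2 * `|u1 - u2|) ->
  (0 < n1)%N -> (0 < n2)%N -> (k < m)%N ->
  scheme_equations Omega a b c d T kx ky alpha1 alpha2 eta f n1 n2 m u ->
  scheme_equations Omega a b c d T kx ky alpha1 alpha2 eta f n1 n2 m v ->
  zero_boundary n1 n2 m u -> zero_boundary n1 n2 m v ->
  grid_max n1 n2 (fun i j => v i j k.+1 - u i j k.+1)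
    <= (1 + tstep T m * c2) * grid_max n1 n2 (fun i j => v i j k - u i j k).
Proof.
move=> ab cd a1 a2 kx0 ky0 eta0 T0 c20 flip n10 n20 km Su Sv Bu Bv.
have m0 : 0 < m%:R :> R by rewrite ltr0n (leq_ltn_trans _ km).
have dt0 : 0 <= tstep T m by rewrite /tstep divr_ge0 ?ltW.
set M := grid_max _ _ (fun i j => v i j k - u i j k).
have [i [j [i1 j1 emax]]] :=
  grid_argmax (fun i j => v i j k.+1 - u i j k.+1) n10 n20.
pose e i' j' := v i' j' k.+1 - u i' j' k.+1.
rewrite -/(e i j) in emax.
apply: (@le_trans _ _ `|e i j|); first exact: ge_grid_max.
have [Bu1 Bu2] := Bu k.+1 km; have [Bv1 Bv2] := Bv k.+1 km.
(* The Gruenwald sums reach the boundary nodes, so maximality must extend to them; the error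
   vanishes there. *)
have emax' i' j' : (i' <= n1.+1)%N -> (j' <= n2.+1)%N -> `|e i' j'| <= `|e i j|.
  move=> i'n j'n.
  have [bdry|] := boolP [|| i' == 0, i' == n1.+1, j' == 0 | j' == n2.+1]%N.
    suff -> : e i' j' = 0 by rewrite normr0.
    move: bdry; rewrite /e => /or4P[] /eqP->.
    - by rewrite (Bu1 _ j'n).1 (Bv1 _ j'n).1 subrr.
    - by rewrite (Bu1 _ j'n).2 (Bv1 _ j'n).2 subrr.
    - by rewrite (Bu2 _ i'n).1 (Bv2 _ i'n).1 subrr.
    - by rewrite (Bu2 _ i'n).2 (Bv2 _ i'n).2 subrr.
  rewrite !negb_or => /and4P[i'0 i'n1 j'0 j'n2].
  by apply: emax; rewrite lt0n -ltnS ltn_neqAle; apply/and3P.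
(* Multiplying by this sign turns a maximum of |e| into a nonnegative maximum of s e, which treats
   positive and negative errors at once. *)
pose s := Num.sg (e i j).
have se : s * e i j = `|e i j| by rewrite /s -normrEsg.
have sle x : s * x <= `|x|.
  apply: le_trans (ler_norm _) _; rewrite normrM -[leRHS]mul1r ler_wpM2r //.
  by rewrite /s normr_sg lern1 leq_b1.
have gx : s * gsum alpha1 n1 (e^~ j) i <= 0.
  rewrite -gsumZ; apply: gsum_max_le0 => //; first by rewrite se.
  move=> i' i'n; rewrite se; apply: le_trans (sle _) _; apply: emax' => //; exact: leqW (andP j1).2.
have gy : s * gsum alpha2 n2 (e i) j <= 0.
  rewrite -gsumZ; apply: gsum_max_le0 => //; first by rewrite se.
  move=> j' j'n; rewrite se; apply: le_trans (sle _) _; apply: emax' => //; exact: leqW (andP i1).2.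
have := Su i j k.+1 i1 j1 km; have := Sv i j k.+1 i1 j1 km.
rewrite /e gsumB in gx; rewrite /e gsumB in gy.
set cx := diffusion_coef _ kx _ _; set cy := diffusion_coef _ ky _ _ => /=.
have cx0 : 0 <= cx by exact: diffusion_coef_ge0.
have cy0 : 0 <= cy by exact: diffusion_coef_ge0.
set x := node a b n1 i; set y := node c d n2 j.
have p0 : 0 <= penalty_coef Omega (tstep T m) eta x y.
  by rewrite penalty_coef_ge0 // ltW.
set p := penalty_coef _ _ _ _ _ in p0 *.
move=> Ev Eu.
have xy : rectangle a b c d (x, y).
  by split; rewrite /= in_itv /= node_itv.
have tT : 0 <= tnode T m k <= T.
  rewrite /tnode mulr_ge0 //= /tstep mulrCA ger_pMr // ler_pdivrMr // mul1r.
  by rewrite ler_nat ltnW.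
have := flip (v i j k) (u i j k) x y _ xy tT.
move: Ev Eu gx gy se.
have := le_grid_max (fun i j => v i j k - u i j k) i1 j1; rewrite -/M /e.
set fv := ext0 _ _ _ _ _ _; set fu := ext0 _ _ _ _ _ _.
set gvx := gsum alpha1 _ _ _; set gux := gsum alpha1 _ _ _.
set gvy := gsum alpha2 _ _ _; set guy := gsum alpha2 _ _ _.
set dt := tstep T m in dt0 *.
move=> eM Ev Eu gx gy se fle.
(* The difference of the two schemes at the extremal node, times s. On the left, the diffusion and
   penalty terms add nonnegative amounts to the modulus of the new error. *)
have lhs : `|v i j k.+1 - u i j k.+1| * (1 + p) - cx * (s * (gvx - gux))
    - cy * (s * (gvy - guy)) = s * (v i j k - u i j k) + dt * (s * (fv - fu)).
  rewrite -se; transitivity (s * ((v i j k.+1 - cx * gvx - cy * gvy + p * v i j k.+1)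
    - (u i j k.+1 - cx * gux - cy * guy + p * u i j k.+1))); first ring.
  by rewrite Ev Eu; ring.
have hx : cx * (s * (gvx - gux)) <= 0 by rewrite mulr_ge0_le0.
have hy : cy * (s * (gvy - guy)) <= 0 by rewrite mulr_ge0_le0.
have hp : 0 <= `|v i j k.+1 - u i j k.+1| * p by rewrite mulr_ge0.
have he := le_trans (sle (v i j k - u i j k)) eM.
have hf : dt * (s * (fv - fu)) <= dt * (c2 * M).
  rewrite ler_wpM2l //; apply: le_trans (sle _) _; apply: le_trans fle _.
  by rewrite ler_pM2l.
by rewrite mulrDl mul1r -mulrA; lra.
Qed.

Theorem lemma3p2 (R : realType) (Omega : set (R * R)) (a b c d : R)
    (T kx ky alpha1 alpha2 eta c2 : R) (f : R -> R -> R -> R -> R) :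
  a < b -> c < d ->
  convex_region Omega -> Omega `<=` rectangle a b c d ->
  1 < alpha1 < 2 -> 1 < alpha2 < 2 ->
  0 < kx -> 0 < ky -> 0 < eta -> 0 < T -> 0 < c2 ->
  (forall u x y : R, Omega (x, y) ->
     [lipschitz (f u x y t : R^o) | t in (`[0, T]%classic : set R^o)]) ->
  (forall u1 u2 x y t : R, rectangle a b c d (x, y) -> 0 <= t <= T ->
     `|ext0 Omega f u1 x y t - ext0 Omega f u2 x y t| <= c2 * `|u1 - u2|) ->
  exists C : R, 0 < C /\
    forall n1 n2 m : nat, (0 < n1)%N -> (0 < n2)%N -> (0 < m)%N ->
    forall (u0 v0 : R -> R -> R) (u v : nat -> nat -> nat -> R),
      scheme_solution Omega a b c d T kx ky alpha1 alpha2 eta f n1 n2 m u0 u ->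
      scheme_solution Omega a b c d T kx ky alpha1 alpha2 eta f n1 n2 m v0 v ->
      forall k : nat, (1 <= k <= m)%N ->
        grid_max n1 n2 (fun i j => v i j k - u i j k)
        <= C * grid_max n1 n2 (fun i j => v i j 0%N - u i j 0%N).
Proof.
move=> ab cd _ _ a1 a2 kx0 ky0 eta0 T0 c20 _ flip.
exists (expR (c2 * T)); split; first exact: expR_gt0.
move=> n1 n2 m n10 n20 m0 u0 v0 u v [Su Bu _] [Sv Bv _] k /andP[_ km].
set M0 := grid_max _ _ (fun i j => v i j 0%N - u i j 0%N).
have q0 : 0 <= tstep T m * c2 by rewrite !mulr_ge0 ?invr_ge0 // ltW.
have growth : forall k, (k <= m)%N ->
    grid_max n1 n2 (fun i j => v i j k - u i j k)
    <= (1 + tstep T m * c2) ^+ k * M0.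
  elim=> [|l IHl] lm; first by rewrite mul1r.
  apply: le_trans (scheme_step ab cd a1 a2 kx0 ky0 eta0 T0 c20 flip
    n10 n20 lm Su Sv Bu Bv) _.
  by rewrite exprS -mulrA ler_wpM2l ?addr_ge0 // IHl // ltnW.
apply: le_trans (growth k km) _; rewrite ler_wpM2r ?grid_max_ge0 //.
(* Powers of a number at least 1 increase, so the last time level bounds all earlier ones. *)
apply: (@le_trans _ _ ((1 + tstep T m * c2) ^+ m)).
  by rewrite ler_weXn2l // lerDl.
(* Since m steps make up T, the exponential splits into m equal factors, each dominating
   [1 + tstep T m * c2] by 1 + x <= exp x. *)
have -> : c2 * T = m%:R * (tstep T m * c2).
  by rewrite /tstep; field; rewrite pnatr_eq0 -lt0n.
by rewrite expRM_natl lerXn2r ?nnegrE ?expR_ge0 ?addr_ge0 // expR_ge1Dx.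
Qed.
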